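(* Let $0<d<n$, let $\bar U\in\mathbb{R}^{n\times d}$ have orthonormal columns, and let the noise-free GROUSE algorithm be run on observations $x_t=v_t=\bar U s_t$ with $\mathbb{E}s_t=0$, $\mathrm{Cov}(s_t)=\mathbb{I}_d$ and $\|v_t\|^2<\infty$. Suppose that at iteration $k$ we have $\zeta_k\ge 1/2$. Then for any $\rho\in(0,1)$ and given accuracy $\epsilon^*>0$, after $$K_2\ \ge\ 2d\log\left(\frac{1}{\epsilon^*\rho}\right)$$ additional iterations of GROUSE, we have $$\mathbb{P}\left(\epsilon_{k+K_2}\le\epsilon^*\right)\ \ge\ 1-\rho .$$
   Context: $\|\cdot\|$ is the Euclidean norm. Data model. $v_t=\bar U s_t$, where the random coefficient vectors $s_t\in\mathbb{R}^d$ are sampled at each step (independently of the past, hence of the current iterate $U_t$) from a continuous distribution, and have zero-mean, uncorrelated, identically distributed entries. Noise-free GROUSE algorithm. Given $U_t\in\mathbb{R}^{n\times d}$ with orthonormal columns and $x_t$, put $w_t=\arg\min_w\|U_tw-x_t\|^2=U_t^Tx_t$, $p_t=U_tw_t$, $r_t=x_t-p_t$, $\theta_t=\arctan(\|r_t\|/\|p_t\|)$, and $$U_{t+1}=U_t+\left(\cos(\theta_t)\frac{p_t}{\|p_t\|}+\sin(\theta_t)\frac{r_t}{\|r_t\|}-\frac{p_t}{\|p_t\|}\right)\frac{w_t^T}{\|w_t\|}$$ (the $r_t$-term is read as $0$ if $r_t=0$). Metrics. With principal angles $\phi_i(\bar U,U_t)$ defined by $\cos\phi_i(\bar U,U_t)=\sigma_i(\bar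 U^TU_t)$ (the singular values), $\zeta_t=\det(\bar U^TU_tU_t^T\bar U)=\prod_{i=1}^d\cos^2\phi_i(\bar U,U_t)$ and $\epsilon_t=\sum_{i=1}^d\sin^2\phi_i(\bar U,U_t)=d-\|\bar U^TU_t\|_F^2$.
   Formalization: The formal theorem also assumes that the entries of the direction s_t/‖s_t‖ are uncorrelated (E u_i u_j = 0) with equal second moments; without this the claim fails, e.g. when s_t is mostly near a fixed line. ''ζ_k ≥ 1/2'' is read as conditioning on that event. *)

(* Defs.v *)
From HB Require Import structures.
From mathcomp Require Import all_boot all_order all_algebra.
From mathcomp Require Import all_classical all_reals all_analysis.

Set Implicit Arguments.
Unset Strict Implicit.
Unset Printing Implicit Defensive.

Import Order.TTheory GRing.Theory Num.Theory.
Import numFieldNormedType.Exports.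

Local Open Scope classical_set_scope.
Local Open Scope ring_scope.

(* The library norm on matrices is the sup norm, hence this definition. *)
Definition enorm (R : realType) (m : nat) (x : 'cV[R]_m) : R :=
  Num.sqrt (\sum_i x i 0 ^+ 2).

Definition orthonormal_cols (R : realType) (m n : nat) (U : 'M[R]_(m, n)) :
  Prop := U^T *m U = 1%:M.

(* As 0^-1 = 0, the r-term vanishes when r = 0, and the step leaves U unchanged
   in the degenerate case p = 0 (equivalently w = 0), where the formula of the
   algorithm is undefined. *)
Definition grouse_step (R : realType) (n d : nat)
    (U : 'M[R]_(n, d)) (x : 'cV[R]_n) : 'M[R]_(n, d) :=
  let w := U^T *m x in
  let p := U *m w in
  let r := x - p in
  let theta := atan (enorm r / enorm p) in
  U + (cos theta *: ((enorm p)^-1 *: p)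
       + sin theta *: ((enorm r)^-1 *: r)
       - (enorm p)^-1 *: p) *m ((enorm w)^-1 *: w^T).

Fixpoint grouse (R : realType) (n d : nat)
    (U0 : 'M[R]_(n, d)) (x : nat -> 'cV[R]_n) (t : nat) : 'M[R]_(n, d) :=
  if t is t'.+1 then grouse_step (grouse U0 x t') (x t') else U0.

Definition zeta (R : realType) (n d : nat) (Ubar U : 'M[R]_(n, d)) : R :=
  \det (Ubar^T *m U *m U^T *m Ubar).

Definition epsilon (R : realType) (n d : nat) (Ubar U : 'M[R]_(n, d)) : R :=
  d%:R - \sum_i \sum_j ((Ubar^T *m U) i j) ^+ 2.

(* The numbers cos (phi i) are the singular values of Ubar^T *m U. *)
Definition principal_angles (R : realType) (n d : nat)
    (Ubar U : 'M[R]_(n, d)) (phi : 'I_d -> R) : Prop :=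
  (forall i, 0 <= phi i <= pi / 2) /\
  exists V W : 'M[R]_d, [/\ V^T *m V = 1%:M, W^T *m W = 1%:M &
    Ubar^T *m U = V *m diag_mx (\row_i cos (phi i)) *m W^T].

Lemma zeta_principal_angles (R : realType) (n d : nat)
    (Ubar U : 'M[R]_(n, d)) (phi : 'I_d -> R) :
  principal_angles Ubar U phi -> zeta Ubar U = \prod_i cos (phi i) ^+ 2.
Proof.
move=> [_ [V [W [VV WW E]]]].
have -> : zeta Ubar U = \det ((Ubar^T *m U) *m (Ubar^T *m U)^T).
  by rewrite /zeta trmx_mul trmxK !mulmxA.
rewrite det_mulmx det_tr E !det_mulmx det_diag det_tr.
have hV : \det V ^+ 2 = 1.
  by rewrite expr2 -{1}det_tr -det_mulmx VV det1.
have hW : \det W ^+ 2 = 1.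
  by rewrite expr2 -{1}det_tr -det_mulmx WW det1.
rewrite -expr2 !exprMn hV hW mul1r mulr1 -prodrXl.
by apply: eq_bigr => i _; rewrite mxE.
Qed.

Lemma epsilon_principal_angles (R : realType) (n d : nat)
    (Ubar U : 'M[R]_(n, d)) (phi : 'I_d -> R) :
  principal_angles Ubar U phi -> epsilon Ubar U = \sum_i sin (phi i) ^+ 2.
Proof.
move=> [_ [V [W [VV WW E]]]].
set A := Ubar^T *m U in E *.
have -> : epsilon Ubar U = d%:R - \tr (A *m A^T).
  rewrite /epsilon -/A /mxtrace; congr (_ - _); apply: eq_bigr => i _.
  by rewrite [RHS]mxE; apply: eq_bigr => j _; rewrite [A^T _ _]mxE expr2.
rewrite E !trmx_mul trmxK tr_diag_mx !mulmxA.
rewrite -(mulmxA _ W^T W) WW mulmx1 mxtrace_mulC !mulmxA VV mul1mx.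
rewrite mulmx_diag mxtrace_diag.
have -> : d%:R = \sum_(i < d) (1 : R) by rewrite sumr_const card_ord.
rewrite -sumrB; apply: eq_bigr => i _.
by rewrite !mxE -expr2 sin2cos2.
Qed.

Section probabilistic_notions.
Context (disp : measure_display) (Omega : measurableType disp) (R : realType).
Variable P : probability Omega R.

Definition random_matrix (m n : nat) (X : Omega -> 'M[R]_(m, n)) : Prop :=
  forall i j, measurable_fun [set: Omega] (fun omega => X omega i j).

Definition mx_events (m n : nat) (X : Omega -> 'M[R]_(m, n)) :
  set (set Omega) := [set A | exists i j,
    preimage_set_system [set: Omega] (fun omega => X omega i j) measurable A].

Definition past (n d : nat) (U0 : Omega -> 'M[R]_(n, d))
    (s : nat -> Omega -> 'cV[R]_d) (t : nat) : set (set Omega) :=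
  <<s mx_events U0 `|` \bigcup_(u in [set u | (u < t)%N]) mx_events (s u) >>.

Definition independent_systems (G H : set (set Omega)) : Prop :=
  forall A B, G A -> H B -> P (A `&` B) = (P A * P B)%E.

Definition cond_prob (A B : set Omega) : R :=
  fine (P (A `&` B)) / fine (P B).

(* The coefficient vectors live in R^d, so that Ubar *m s t omega has finite
   norm for every omega. *)
Record data_model (n d : nat) (U0 : Omega -> 'M[R]_(n, d))
    (s : nat -> Omega -> 'cV[R]_d) : Prop := DataModel {
  coef_random : forall t, random_matrix (s t);
  coef_continuous : forall t c, P (s t @^-1` [set c]) = 0%E;
  coef_mean : forall t i, ('E_P[fun omega => (s t omega i 0)%R] = 0)%E;
  coef_cov : forall t i j,
    covariance P (fun omega => s t omega i 0) (fun omega => s t omega j 0)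
    = ((i == j)%:R)%:E;
  coef_ident : forall t i j (B : set R), measurable B ->
    P ((fun omega => s t omega i 0) @^-1` B)
    = P ((fun omega => s t omega j 0) @^-1` B);
  coef_indep : forall t,
    independent_systems <<s mx_events (s t) >> (past U0 s t)
}.

(* GROUSE depends on s only through its direction s / |s|.  Uncorrelated and
   identically distributed entries of s do not make the entries of the direction
   uncorrelated (take a mixture of a short vector close to a diagonal and a rare
   long vector), so this is stated separately. *)
Definition uncorrelated_direction (d : nat) (s : Omega -> 'cV[R]_d) : Prop :=
  let u := fun omega => (enorm (s omega))^-1 *: s omega in
  (forall i j, i != j ->
     ('E_P[fun omega => (u omega i 0 * u omega j 0)%R] = 0)%E) /\
  (forall i j, ('E_P[fun omega => (u omega i 0 ^+ 2)%R]
      = 'E_P[fun omega => (u omega j 0 ^+ 2)%R])%E).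

End probabilistic_notions.

(* Main.v *)
(** Write [A = Ubar^T U], [B = A A^T] and [u = s / |s|].  A GROUSE step replaces
    [A] by [A (1 - q q^T) + u q^T] with [q = A^T u / |A^T u|].  Hence the
    determinant of [A] is divided by [|A^T u| <= 1], so [zeta] never decreases,
    and [epsilon] drops by [1 - |A q|^2 >= u^T (B - B^2) u].  The second moments
    of [u] are [delta_ij / d], and [u] is independent of the past, so the expected
    drop is at least [tr (B - B^2) / d].  Once [zeta >= 1/2], every eigenvalue of
    [B] lies in [[1/2, 1]], so this is at least [epsilon / (2 d)], and moreover
    [epsilon <= 1].  Therefore the expectation of [epsilon] on the starting event
    decays like [(1 - 1 / (2 d))^K2], and Markov's inequality concludes. *)

Require Import Defs.
From mathcomp Require Import all_boot all_order all_algebra.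
From mathcomp Require Import all_classical all_reals all_analysis.
From mathcomp Require Import measurable_realfun complex.
From mathcomp Require Import ring lra.

Set Implicit Arguments.
Unset Strict Implicit.
Unset Printing Implicit Defensive.

Import Order.TTheory GRing.Theory Num.Theory.
Import numFieldNormedType.Exports.

Local Open Scope classical_set_scope.
Local Open Scope ring_scope.

(** * Spectrum of a contraction *)

(** The real symmetric matrix [A A^T] is diagonalised by a unitary matrix over [complex R], and its
    eigenvalues are then shown to be real. The factor [C] encodes that [1 - A A^T] is positive
    semidefinite. *)
Lemma contraction_spectrum (R : rcfType) d m (A : 'M[R]_d) (C : 'M[R]_(m, d)) :
  1%:M - A *m A^T = C^T *m C ->
  exists l : 'I_d -> R, [/\ forall i, 0 <= l i <= 1,
    \tr (A *m A^T) = \sum_i l i,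
    \tr (A *m A^T *m (A *m A^T)) = \sum_i l i ^+ 2 &
    \det (A *m A^T) = \prod_i l i].
Proof.
move=> AC; pose B := A *m A^T.
pose f : {rmorphism R -> complex R} := real_complex R.
pose Bc := map_mx f B.
have freal p q (M : 'M[R]_(p, q)) : map_mx Num.conj (map_mx f M) = map_mx f M.
  apply/matrixP => i j; rewrite !mxE; apply/conj_Creal.
  by apply/complex_realP; exists (M i j).
have Bsym : B^T = B by rewrite /B trmx_mul trmxK.
have Bn : Bc \is normalmx by apply/normalmxP; rewrite -map_trmx freal map_trmx Bsym.
have /orthomx_spectralP := Bn; have := spectral_unitarymx Bc.
set P := spectralmx Bc; set D := spectral_diag Bc => Pu.
have Punit := unitarymx_unit Pu.
have PP := unitarymxP Pu.
move=> BE.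
have PBP : P *m Bc *m (map_mx Num.conj P^T) = diag_mx D.
  by rewrite BE -(invmx_unitary Pu) !mulmxA mulmxV// mul1mx -mulmxA mulmxV// mulmx1.
(* This diagonal entry is the squared norm of row [i] of [P N]. Taking [N = A] gives nonnegative
   eigenvalues, and [N = C^T], whose Gram matrix is [1 - A A^T], gives the upper bound 1. *)
have nnneg k (N : 'M[R]_(d, k)) i :
    0 <= (P *m map_mx f (N *m N^T) *m (map_mx Num.conj P^T)) i i.
  rewrite map_mxM mulmxA -mulmxA -[X in map_mx f X](trmxK) trmxK.
  have -> : map_mx f N^T *m map_mx Num.conj P^T = map_mx Num.conj (P *m map_mx f N)^T.
    by rewrite trmx_mul map_mxM map_trmx freal.
  by rewrite mxE sumr_ge0// => j _; rewrite !mxE -normCK exprn_ge0.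
have D0 i : 0 <= D 0 i.
  by have := nnneg _ A i; rewrite -/B PBP !mxE eqxx mulr1n.
have D1 i : D 0 i <= 1.
  have := nnneg _ C^T i; rewrite trmxK -AC map_mxB -/B map_mx1 mulmxBr mulmxBl mulmx1 PP.
  by rewrite PBP !mxE eqxx !mulr1n subr_ge0.
pose l i := complex.Re (D 0 i).
have lE i : f (l i) = D 0 i by apply/RRe_real/ger0_real.
have finj : injective f by exact: fmorph_inj.
(* Cyclicity of the trace; [k = 1] and [k = Bc] give the first and second power sums. *)
have trE k : \tr (Bc *m k) = \tr (diag_mx D *m (P *m k *m invmx P)).
  by rewrite BE -!mulmxA mxtrace_mulC -!mulmxA.
exists l; split.
- by move=> i; rewrite -ler0c -lecR; rewrite -[_%:C%C]/(f (l i)) lE D0 D1.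
- apply: finj; rewrite -/B -trace_map_mx rmorph_sum.
  have := trE 1%:M; rewrite !mulmx1 mulmxV// mulmx1 => ->.
  by rewrite mxtrace_diag; apply: eq_bigr => i _; rewrite -lE.
- apply: finj; rewrite -/B -trace_map_mx rmorph_sum map_mxM/=.
  rewrite trE; have -> : P *m map_mx f B *m invmx P = diag_mx D.
    by rewrite -/Bc invmx_unitary.
  rewrite mulmx_diag mxtrace_diag; apply: eq_bigr => i _.
  by rewrite mxE -lE rmorphXn/= expr2.
- apply: finj; rewrite -/B -det_map_mx rmorph_prod -/Bc BE !det_mulmx mulrAC -det_mulmx.
  rewrite mulVmx// det1 mul1r det_diag.
  by apply: eq_bigr => i _; rewrite -lE.
Qed.

(** All factors are at most 1, so each one dominates the product. For the sum [S] of the defects,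
    [l <= exp (- (1 - l))] yields [exp S <= 2], and [1 + S <= exp S] concludes. *)
Lemma half_prod_bounds (R : realType) d (l : 'I_d -> R) :
  (forall i, 0 <= l i <= 1) -> 1 / 2 <= \prod_i l i ->
  (forall i, 1 / 2 <= l i) /\ \sum_i (1 - l i) <= 1.
Proof.
move=> l01 pl; split=> [i|].
  apply: le_trans pl _; rewrite (bigD1 i)//=.
  have /andP[l0 l1] := l01 i.
  rewrite -[leRHS]mulr1 ler_wpM2l//.
  apply: (@le_trans _ _ (\prod_(j | j != i) 1)); last by rewrite big1_eq.
  exact: ler_prod.
have : \prod_i l i <= expR (- \sum_i (1 - l i)).
  rewrite -sumrN expR_sum; apply: ler_prod => i _.
  have /andP[-> _] := l01 i; apply: le_trans (expR_ge1Dx _).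
  by lra.
set S := \sum_i _; rewrite expRN => lS.
have e0 := expR_gt0 S.
have : expR S <= 2.
  have := le_trans pl lS; rewrite div1r lef_pV2//.
  by rewrite posrE.
have := expR_ge1Dx S; lra.
Qed.

(** * Effect of one GROUSE step *)

Lemma enorm_ge0 (R : realType) m (x : 'cV[R]_m) : 0 <= enorm x.
Proof. exact: sqrtr_ge0. Qed.

Lemma sqr_enorm (R : realType) m (x : 'cV[R]_m) : enorm x ^+ 2 = (x^T *m x) 0 0.
Proof.
rewrite sqr_sqrtr ?sumr_ge0// => [|i _]; last exact: sqr_ge0.
by rewrite mxE; apply: eq_bigr => i _; rewrite mxE expr2.
Qed.

Lemma mul_trmx_enorm (R : realType) m (x : 'cV[R]_m) :
  x^T *m x = (enorm x ^+ 2)%:M.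
Proof. by rewrite sqr_enorm -mx11_scalar. Qed.

Lemma enorm_eq0 (R : realType) m (x : 'cV[R]_m) : (enorm x == 0) = (x == 0).
Proof.
apply/eqP/eqP => [x0|->]; last first.
  by rewrite /enorm big1 ?sqrtr0// => i _; rewrite mxE expr0n.
have := sqr_enorm x; rewrite x0 expr0n mxE => /esym/eqP.
rewrite psumr_eq0 => [/allP x00|i _]; last by rewrite mxE -expr2 sqr_ge0.
apply/matrixP => i j; rewrite ord1 !mxE; have := x00 i (mem_index_enum _).
by rewrite mxE mulf_eq0 orbb => /eqP.
Qed.

Lemma enorm_isometry (R : realType) n d (U : 'M[R]_(n, d)) (w : 'cV[R]_d) :
  orthonormal_cols U -> enorm (U *m w) = enorm w.
Proof.
move=> UU; apply/eqP; rewrite -(eqrXn2 (ltn0Sn 1)) ?enorm_ge0//.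
by rewrite !sqr_enorm trmx_mul -mulmxA (mulmxA U^T) UU mul1mx.
Qed.

Lemma normalized_unit (R : realType) m (x : 'cV[R]_m) : x != 0 ->
  ((enorm x)^-1 *: x)^T *m ((enorm x)^-1 *: x) = 1%:M.
Proof.
rewrite -enorm_eq0 => x0; rewrite -scalemxAr [(_ *: x)^T]linearZ/= -scalemxAl scalerA.
rewrite mul_trmx_enorm scale_scalar_mx; congr (_%:M).
by rewrite -invfM -expr2 mulVf// expf_neq0.
Qed.

Lemma sin_atan (R : realType) (x : R) : sin (atan x) = x * cos (atan x).
Proof.
rewrite -{2}[x]atanK /tan divfK//; rewrite cos_atan invr_eq0.
by rewrite sqrtr_eq0 -ltNge ltr_wpDr ?sqr_ge0.
Qed.

(** Pythagoras for the orthogonal projection onto the range of [U], which is isometric to the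
    coefficient space. *)
Lemma enorm_residual (R : realType) n d (U : 'M[R]_(n, d)) (x : 'cV[R]_n) :
  orthonormal_cols U ->
  enorm x ^+ 2 = enorm (U^T *m x) ^+ 2 + enorm (x - U *m (U^T *m x)) ^+ 2.
Proof.
move=> UU; set w := U^T *m x.
have xw : x^T *m U = w^T by rewrite trmx_mul trmxK.
rewrite !sqr_enorm [(_ - _)^T]linearB/= mulmxBl !mulmxBr.
rewrite (trmx_mul U) -!mulmxA -/w (mulmxA U^T) UU mul1mx (mulmxA x^T) xw.
by rewrite subrr subr0 !mxE; ring.
Qed.

(** By Pythagoras [cos theta = |p| / |x|] and [sin theta = |r| / |x|], so the rotated vector is just
    [x / |x|]. The step is thus the rank-one update sending [w / |w|] to [x / |x|]; for [w = 0] both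
    sides are [U]. *)
Lemma grouse_stepE (R : realType) n d (U : 'M[R]_(n, d)) (x : 'cV[R]_n) :
  orthonormal_cols U ->
  let w := U^T *m x in
  grouse_step U x = U + ((enorm x)^-1 *: x - U *m ((enorm w)^-1 *: w))
                        *m ((enorm w)^-1 *: w)^T.
Proof.
move=> UU w; rewrite /grouse_step -/w enorm_isometry//.
have [->|w0] := eqVneq w 0.
  by rewrite trmx0 !scaler0 trmx0 !mulmx0.
rewrite [(_ *: w)^T]linearZ/=; congr (_ + _ *m _).
set p := U *m w; set r := x - p.
have a0 : 0 < enorm w by rewrite lt0r enorm_eq0 w0 enorm_ge0.
have cE : enorm x ^+ 2 = enorm w ^+ 2 + enorm r ^+ 2 by exact: enorm_residual.
have c0 : 0 < enorm x.
  rewrite lt0r enorm_ge0 andbT -sqrf_eq0; apply/lt0r_neq0.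
  by rewrite cE ltr_wpDr ?sqr_ge0 ?exprn_gt0.
have cosE : cos (atan (enorm r / enorm w)) = enorm w / enorm x.
  rewrite cos_atan -[RHS]invrK invf_div; congr (_^-1).
  rewrite -[RHS]ger0_norm ?divr_ge0 ?enorm_ge0// -sqrtr_sqr; congr Num.sqrt.
  by rewrite !exprMn !exprVn cE mulrDl mulfV// expf_neq0 ?gt_eqF.
rewrite sin_atan cosE -scalemxAr -/p.
rewrite scalerA [enorm w / _]mulrC mulfK ?gt_eqF// scalerA.
congr (_ - _); have [r0|r0] := eqVneq r 0.
  by rewrite r0 scaler0 addr0 (_ : x = p)//; apply/eqP; rewrite -subr_eq0 -/r r0.
have -> : enorm r / enorm w * ((enorm x)^-1 * enorm w) / enorm r = (enorm x)^-1.
  by field; rewrite (gt_eqF a0) (gt_eqF c0) enorm_eq0 r0.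
by rewrite -scalerDr /r addrC subrK.
Qed.

(** With [v = y - U q] one has [U^T v = (c - 1) q] and [|v|^2 = 2 - 2 c], so the coefficient of
    [q q^T] in the Gram matrix is [2 (c - 1) + (2 - 2 c) = 0]. *)
Lemma rank1_update_orthonormal (R : realType) n d (U : 'M[R]_(n, d))
    (y : 'cV[R]_n) (q : 'cV[R]_d) (c : R) :
  orthonormal_cols U -> y^T *m y = 1%:M -> q^T *m q = 1%:M -> U^T *m y = c *: q ->
  orthonormal_cols (U + (y - U *m q) *m q^T).
Proof.
move=> UU yy qq Uy; set v := y - U *m q.
have Uv : U^T *m v = (c - 1) *: q.
  by rewrite mulmxBr Uy mulmxA UU mul1mx scalerBl scale1r.
have vU : v^T *m U = (c - 1) *: q^T by rewrite -[LHS]trmxK trmx_mul trmxK Uv linearZ.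
have vv : v^T *m v = (2 - 2 * c)%:M.
  rewrite {2}/v mulmxBr mulmxA vU -scalemxAl qq [v^T]linearB/= mulmxBl yy.
  rewrite trmx_mul -mulmxA Uy -scalemxAr qq !scale_scalar_mx -!raddfB/=.
  by congr _%:M; ring.
rewrite /orthonormal_cols [(U + _)^T]linearD/= mulmxDl !mulmxDr UU trmx_mul trmxK.
rewrite (mulmxA U^T) Uv -(mulmxA q v^T U) vU -(mulmxA q v^T) (mulmxA v^T) vv.
rewrite mul_scalar_mx -scalemxAl -!scalemxAr -addrA -!scalerDl.
by rewrite [X in X *: _](_ : _ = 0) ?scale0r ?addr0//; ring.
Qed.

Lemma grouse_step_orthonormal (R : realType) n d (U : 'M[R]_(n, d)) (x : 'cV[R]_n) :
  orthonormal_cols U -> orthonormal_cols (grouse_step U x).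
Proof.
move=> UU; rewrite grouse_stepE//; set w := U^T *m x.
have [->|w0] := eqVneq w 0.
  by rewrite scaler0 trmx0 mulmx0 addr0.
have x0 : x != 0 by apply: contra_neq w0; rewrite /w => ->; rewrite mulmx0.
apply: (@rank1_update_orthonormal _ _ _ _ _ _ (enorm w / enorm x)) => //;
  try exact: normalized_unit.
rewrite -scalemxAr scalerA -/w; congr (_ *: _).
by field; rewrite !enorm_eq0 w0 x0.
Qed.

(** Since [A' = A (1 - q q^T) + u q^T] and [(1 - q q^T) q = 0], the cross terms vanish. *)
Lemma rank1_update_gram (R : comPzRingType) m d (A : 'M[R]_(m, d))
    (u : 'cV[R]_m) (q : 'cV[R]_d) : q^T *m q = 1%:M ->
  let A' := A + (u - A *m q) *m q^T in
  A' *m A'^T = A *m A^T - (A *m q) *m (A *m q)^T + u *m u^T.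
Proof.
move=> qq /=; set z := A *m q; set v := u - z.
rewrite [(A + _)^T]linearD/= trmx_mul trmxK mulmxDl !mulmxDr.
rewrite (mulmxA A q) -/z -(mulmxA v q^T A^T) -trmx_mul -/z.
rewrite -(mulmxA v) (mulmxA q^T) qq mul1mx /v [(u - z)^T]linearB/= !mulmxBr !mulmxBl.
rewrite !opprB -!addrA; congr (_ + _).
by apply/matrixP => i j; rewrite !mxE; ring.
Qed.

(** The matrix determinant lemma: the same two block matrices are multiplied in both orders, each
    product is block triangular, and the determinants agree. *)
Lemma det_id_rank1 (R : comPzRingType) d (v q : 'cV[R]_d) :
  \det (1%:M + v *m q^T) = 1 + (q^T *m v) 0 0.
Proof.
have E1 : block_mx 1%:M (- q^T) v 1%:M *m block_mx 1%:M q^T 0 1%:M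
    = block_mx (1%:M : 'M[R]_1) 0 v (1%:M + v *m q^T).
  by rewrite mulmx_block !mul1mx !mulmx0 !mulmx1 !addr0 subrr [v *m _ + _]addrC.
have E2 : block_mx 1%:M q^T 0 1%:M *m block_mx 1%:M (- q^T) v 1%:M
    = block_mx (1%:M + q^T *m v : 'M[R]_1) 0 v 1%:M.
  by rewrite mulmx_block !mul1mx !mul0mx !mulmx1 !add0r addNr.
have := congr1 (determinant (R:=R) (n:=1+d)) E1.
rewrite det_mulmx mulrC -det_mulmx E2 !det_lblock !det1 mul1r mulr1 => <-.
by rewrite [X in determinant X]mx11_scalar det_scalar1 !mxE.
Qed.

(** * The overlap matrix of two subspaces *)

Definition overlap (R : realType) n d (Ubar U : 'M[R]_(n, d)) : 'M[R]_d :=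
  Ubar^T *m U *m (Ubar^T *m U)^T.

Lemma zetaE (R : realType) n d (Ubar U : 'M[R]_(n, d)) :
  zeta Ubar U = \det (overlap Ubar U).
Proof. by rewrite /zeta /overlap trmx_mul trmxK !mulmxA. Qed.

Lemma epsilonE (R : realType) n d (Ubar U : 'M[R]_(n, d)) :
  epsilon Ubar U = d%:R - \tr (overlap Ubar U).
Proof.
rewrite /epsilon /overlap; set A := Ubar^T *m U.
rewrite /mxtrace; congr (_ - _); apply: eq_bigr => i _.
by rewrite [RHS]mxE; apply: eq_bigr => j _; rewrite [A^T _ _]mxE expr2.
Qed.

(** The residual of [Ubar] after projection onto the range of [U] has Gram matrix
    [1 - overlap Ubar U]. *)
Lemma overlap_spectrum (R : realType) n d (Ubar U : 'M[R]_(n, d)) :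
  orthonormal_cols Ubar -> orthonormal_cols U ->
  exists l : 'I_d -> R, [/\ forall i, 0 <= l i <= 1,
    \tr (overlap Ubar U) = \sum_i l i,
    \tr (overlap Ubar U *m overlap Ubar U) = \sum_i l i ^+ 2 &
    \det (overlap Ubar U) = \prod_i l i].
Proof.
move=> VV UU; apply: (@contraction_spectrum _ _ _ _ (Ubar - U *m (U^T *m Ubar))).
rewrite [(_ - _)^T]linearB/= mulmxBl !mulmxBr VV !trmx_mul !trmxK.
by rewrite -!mulmxA (mulmxA U^T U) UU mul1mx subrr subr0.
Qed.

Lemma epsilon_bounds (R : realType) n d (Ubar U : 'M[R]_(n, d)) :
  orthonormal_cols Ubar -> orthonormal_cols U -> 0 <= epsilon Ubar U <= d%:R.
Proof.
move=> VV UU; have [l [l01 trl _ _]] := overlap_spectrum VV UU.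
rewrite epsilonE trl subr_ge0 lerBlDr lerDl sumr_ge0 => [|i _]; last first.
  by case/andP: (l01 i).
rewrite andbT; apply: (@le_trans _ _ (\sum_(i < d) 1)).
  by apply: ler_sum => i _; case/andP: (l01 i).
by rewrite sumr_const card_ord.
Qed.

(** On eigenvalues, [epsilon] is the sum of [1 - l] and the trace is the sum of [l (1 - l)], with
    every [l >= 1/2]. *)
Lemma epsilon_zeta_half (R : realType) n d (Ubar U : 'M[R]_(n, d)) :
  orthonormal_cols Ubar -> orthonormal_cols U -> 1 / 2 <= zeta Ubar U ->
  epsilon Ubar U <= 1 /\
  epsilon Ubar U / 2 <= \tr (overlap Ubar U - overlap Ubar U *m overlap Ubar U).
Proof.
move=> VV UU; have [l [l01 trl trl2 detl]] := overlap_spectrum VV UU.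
rewrite zetaE detl => /(half_prod_bounds l01)[l2 l1].
have epsE : epsilon Ubar U = \sum_i (1 - l i).
  by rewrite epsilonE trl sumrB sumr_const card_ord.
split; first by rewrite epsE.
rewrite epsE [\tr _]linearB/= trl trl2 mulr_suml -sumrB; apply: ler_sum => i _.
have := l2 i; case/andP: (l01 i); nra.
Qed.

Lemma grouse_step_degenerate (R : realType) n d (U : 'M[R]_(n, d)) :
  grouse_step U 0 = U.
Proof. by rewrite /grouse_step !mulmx0 trmx0 !scaler0 mulmx0 addr0. Qed.

Lemma enorm_trmx_mul_le (R : realType) n d (U : 'M[R]_(n, d)) (x : 'cV[R]_n) :
  orthonormal_cols U -> enorm (U^T *m x) <= enorm x.
Proof.
move=> UU; rewrite -(ler_pXn2r (ltn0Sn 1)) ?nnegrE ?enorm_ge0//.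
by rewrite [leRHS](enorm_residual x UU) lerDl sqr_ge0.
Qed.

(** Seen through [Ubar^T], the step is again a rank-one update, now of a square matrix, so both its
    Gram matrix and its determinant can be computed. *)
Lemma overlap_grouse_step (R : realType) n d (Ubar U : 'M[R]_(n, d)) (s : 'cV[R]_d) :
  orthonormal_cols Ubar -> orthonormal_cols U ->
  let A := Ubar^T *m U in
  let u := (enorm s)^-1 *: s in
  let q := (enorm (A^T *m s))^-1 *: (A^T *m s) in
  Ubar^T *m grouse_step U (Ubar *m s) = A + (u - A *m q) *m q^T.
Proof.
move=> VV UU A u q; rewrite grouse_stepE// enorm_isometry//=.
have -> : U^T *m (Ubar *m s) = A^T *m s by rewrite /A trmx_mul trmxK mulmxA.
rewrite -/q mulmxDr [in LHS]mulmxA mulmxBr -[in LHS]scalemxAr !mulmxA VV.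
by rewrite mul1mx.
Qed.

Section step.
Variables (R : realType) (n d : nat) (Ubar U : 'M[R]_(n, d)) (s : 'cV[R]_d).
Hypotheses (VV : orthonormal_cols Ubar) (UU : orthonormal_cols U).
Hypothesis zeta_gt0 : 0 < zeta Ubar U.

Let A := Ubar^T *m U.
Let u := (enorm s)^-1 *: s.

(** Invertibility of [A] ensures [A^T s != 0] for [s != 0], which rules out the degenerate step. *)
Let Au : A \in unitmx.
Proof.
rewrite unitmxE unitfE; move: (lt0r_neq0 zeta_gt0).
by rewrite zetaE /overlap det_mulmx mulf_eq0 => /norP[].
Qed.

Let q_unit : s != 0 ->
  let q := (enorm (A^T *m s))^-1 *: (A^T *m s) in q^T *m q = 1%:M.
Proof.
move=> s0; apply: normalized_unit; apply: contra_neq s0 => As0.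
have : A^T \in unitmx by rewrite unitmx_tr.
by move=> AT; rewrite -[s](mulKmx AT) As0 mulmx0.
Qed.

(** Normalised by [|s|]: it has the direction of [A^T s], and for [s != 0] its norm, in []0, 1]], is
    the number by which a step divides [\det A]. *)
Let w := A^T *m u.

Let wE : enorm s *: w = A^T *m s.
Proof.
rewrite /w /u -scalemxAr scalerA; have [->|s0] := eqVneq s 0.
  by rewrite mulmx0 scaler0.
by rewrite mulfV ?scale1r// enorm_eq0.
Qed.

Let q_dir : s != 0 ->
  (enorm (A^T *m s))^-1 *: (A^T *m s) = (enorm w)^-1 *: w.
Proof.
rewrite -enorm_eq0 => s0; rewrite -wE scalerA; congr (_ *: _).
suff -> : enorm (enorm s *: w) = enorm s * enorm w.
  by rewrite invfM mulrC mulrA mulfV// mul1r.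
apply/eqP; rewrite -(eqrXn2 (ltn0Sn 1)) ?mulr_ge0 ?enorm_ge0//.
rewrite exprMn [in X in X == _]sqr_enorm -scalemxAr [(_ *: w)^T]linearZ/=.
by rewrite -scalemxAl scalerA mul_trmx_enorm !mxE eqxx mulr1n -expr2.
Qed.

Let w_neq0 : s != 0 -> enorm w != 0.
Proof.
move=> s0; have := q_unit s0; rewrite /= q_dir//; apply: contra_eq_neq => ->.
rewrite invr0 scale0r trmx0 mul0mx eq_sym.
by apply/eqP => /matrixP/(_ 0 0)/eqP; rewrite !mxE oner_eq0.
Qed.

Let w_le1 : s != 0 -> enorm w <= 1.
Proof.
move=> s0; have -> : w = U^T *m (Ubar *m u) by rewrite /w /A trmx_mul trmxK mulmxA.
apply: le_trans (enorm_trmx_mul_le _ UU) _; rewrite enorm_isometry//.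
by rewrite -(ler_pXn2r (ltn0Sn 1)) ?nnegrE ?enorm_ge0// sqr_enorm normalized_unit// mxE expr1n.
Qed.

Lemma zeta_grouse_step : zeta Ubar U <= zeta Ubar (grouse_step U (Ubar *m s)).
Proof.
have [->|s0] := eqVneq s 0; first by rewrite mulmx0 grouse_step_degenerate.
rewrite !zetaE /overlap overlap_grouse_step// -/A -/u q_dir//.
set q := _ *: _; have qq : q^T *m q = 1%:M by rewrite /q -q_dir// q_unit.
(* Factoring out [A] leaves a rank-one perturbation of the identity, of determinant
   [q^T A^-1 u = 1 / |w|]. *)
have -> : A + (u - A *m q) *m q^T = A *m (1%:M + (invmx A *m u - q) *m q^T).
  by rewrite mulmxDr mulmx1 mulmxA mulmxBr mulmxA mulmxV// mul1mx.
have qAu : q^T *m (invmx A *m u) = (enorm w)^-1%:M.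
  rewrite [q^T]linearZ/= -scalemxAl /w (trmx_mul A^T u) trmxK -mulmxA (mulmxA A) mulmxV//.
  by rewrite mul1mx normalized_unit// scale_scalar_mx mulr1.
rewrite !det_mulmx !det_tr !det_mulmx det_id_rank1 mulmxBr qAu qq !mxE !mulr1n.
rewrite [1 + _](_ : _ = (enorm w)^-1); last by ring.
rewrite mulrACA -!expr2 ler_peMr ?sqr_ge0// exprVn invf_ge1.
  by rewrite exprn_ile1 ?enorm_ge0 ?w_le1.
by rewrite exprn_gt0// lt0r w_neq0 ?enorm_ge0.
Qed.

(** The exact drop is [1 - |A w|^2 / |w|^2]. It is bounded below by a quadratic form in [u], because
    the expectation of such a form only involves second moments of [u]. *)
Lemma epsilon_grouse_step :
  epsilon Ubar (grouse_step U (Ubar *m s)) <= epsilon Ubar U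
  - (u^T *m (overlap Ubar U - overlap Ubar U *m overlap Ubar U) *m u) 0 0.
Proof.
have [s0|s0] := eqVneq s 0.
  by rewrite /u s0 scaler0 !mulmx0 grouse_step_degenerate mxE subr0.
rewrite !epsilonE /overlap overlap_grouse_step// -/A -/u q_dir//.
set q := _ *: _; have qq : q^T *m q = 1%:M by rewrite /q -q_dir// q_unit.
rewrite rank1_update_gram// [\tr _]linearD/= [\tr (_ - _)]linearB/=.
have c0 : 0 < enorm w ^+ 2 by rewrite exprn_gt0// lt0r w_neq0 ?enorm_ge0.
have c1 : enorm w ^+ 2 <= 1 by rewrite exprn_ile1 ?enorm_ge0 ?w_le1.
have uBu : (u^T *m (A *m A^T - A *m A^T *m (A *m A^T)) *m u) 0 0
    = enorm w ^+ 2 - enorm (A *m w) ^+ 2.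
  rewrite mulmxBr mulmxBl !sqr_enorm (trmx_mul A w) (trmx_mul A^T u) trmxK !mulmxA.
  by rewrite !mxE.
have Aw : enorm (A *m w) ^+ 2 <= enorm w ^+ 2.
  rewrite ler_pXn2r ?nnegrE ?enorm_ge0// /A -mulmxA.
  by apply: le_trans (enorm_trmx_mul_le _ VV) _; rewrite enorm_isometry.
have tru : \tr (u *m u^T) = 1.
  by rewrite mxtrace_mulC normalized_unit// mxtrace1.
have trq : \tr (A *m q *m (A *m q)^T) = enorm (A *m w) ^+ 2 / enorm w ^+ 2.
  rewrite mxtrace_mulC /q -scalemxAr -scalemxAr [(_ *: (A *m w))^T]linearZ/=.
  by rewrite -scalemxAl scalerA mul_trmx_enorm scale_scalar_mx mxtrace_scalar
     mulr1n mulrC -invfM -expr2.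
rewrite tru trq uBu.
set c := enorm w ^+ 2 in c0 c1 Aw *; set g := _ ^+ 2 in Aw *.
(* Expanded, this says that the exact drop [1 - g / c] is at least the quadratic form [c - g]. *)
suff : 0 <= (1 - g / c) * (1 - c).
  have cK : g / c * c = g by rewrite divfK// gt_eqF.
  rewrite mulrBr mulrBl mul1r mulr1 mulrBl cK; lra.
by rewrite mulr_ge0 ?subr_ge0// ler_pdivrMr// mul1r.
Qed.
End step.

(** * Expectations of bounded random variables *)

(** Independence makes the joint law agree with the product of the marginals on rectangles, hence
    everywhere; Fubini then factors the integral of the product. *)
Lemma Rintegral_independentM (disp : measure_display) (Omega : measurableType disp)
    (R : realType) (P : probability Omega R) (X Y : Omega -> R) :
  measurable_fun setT X -> measurable_fun setT Y ->
  P.-integrable setT (EFin \o X) -> P.-integrable setT (EFin \o Y) ->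
  P.-integrable setT (EFin \o (fun omega => X omega * Y omega)) ->
  (forall A B : set R, measurable A -> measurable B ->
    P (X @^-1` A `&` Y @^-1` B) = (P (X @^-1` A) * P (Y @^-1` B))%E) ->
  \int[P]_omega (X omega * Y omega) = \int[P]_omega X omega * \int[P]_omega Y omega.
Proof.
move=> mX mY iX iY iXY indep.
pose X' : {mfun Omega >-> R} := mfun_Sub (mem_set mX).
pose Y' : {mfun Omega >-> R} := mfun_Sub (mem_set mY).
have mXY : measurable_fun setT (fun omega => (X omega, Y omega)).
  exact: measurable_fun_pair.
pose XY : {mfun Omega >-> (R * R)%type} := mfun_Sub (mem_set mXY).
pose mulE (z : R * R) := (z.1 * z.2)%:E.
have mmulE : measurable_fun [set: R * R] mulE.
  by apply/measurable_EFinP; apply: measurable_funM.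
have jointE C : measurable C ->
    (distribution P X' \x distribution P Y')%E C = distribution P XY C.
  move=> mC; exact: product_measure_unique.
have imul : (distribution P X' \x distribution P Y')%E.-integrable [set: R * R] mulE.
  have /integrableP[_ fin] : (distribution P XY).-integrable [set: R * R] mulE.
    exact: integrable_pushforward.
  apply/integrableP; split => //; apply: le_lt_trans fin.
  by rewrite (eq_measure_integral (distribution P XY))// => C mC _; exact: jointE.
have mid : measurable_fun [set: R] (@EFin R) by exact/measurable_EFinP.
have intX : (distribution P X').-integrable [set: R] EFin.
  exact: integrable_pushforward.
have intY : (distribution P Y').-integrable [set: R] EFin.
  exact: integrable_pushforward.
have EY : (\int[distribution P Y']_y y%:E = (\int[P]_omega Y omega)%:E)%E.
  rewrite integral_distribution//= fineK//; exact: integrable_fin_num.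
have EX : (\int[distribution P X']_y y%:E = (\int[P]_omega X omega)%:E)%E.
  rewrite integral_distribution//= fineK//; exact: integrable_fin_num.
transitivity (fine (\int[distribution P XY]_z mulE z)%E).
  by rewrite integral_distribution.
rewrite -(@eq_measure_integral _ _ _ _ _ (distribution P X' \x distribution P Y')%E); last first.
  by move=> C mC _; exact: jointE.
rewrite -integral12_prod_meas1//.
transitivity (fine (\int[distribution P X']_x (x%:E * (\int[P]_omega Y omega)%:E))%E).
  congr fine; apply: eq_integral => x _.
  by rewrite -EY -integralZl.
by rewrite integralZr// EX.
Qed.

(** Closed under algebraic operations and sufficient for integrability. The measurable type is
    arbitrary, so that [Omega] with a smaller sigma-algebra is covered too. *)
Definition bounded_rv (disp : measure_display) (T : measurableType disp)
    (R : realType) (f : T -> R) : Prop :=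
  measurable_fun setT f /\ exists c, forall x, `|f x| <= c.

Section bounded_rv.
Variables (disp : measure_display) (T : measurableType disp) (R : realType).
Implicit Types f g : T -> R.

Lemma bounded_rv_cst c : bounded_rv (fun _ : T => c : R).
Proof. by split; [exact: measurable_cst|exists `|c|]. Qed.

Lemma bounded_rvB f g :
  bounded_rv f -> bounded_rv g -> bounded_rv (fun x => f x - g x).
Proof.
move=> [mf [a fa]] [mg [b gb]]; split; first exact: measurable_funB.
by exists (a + b) => x; apply: le_trans (ler_normB _ _) _; exact: lerD.
Qed.

Lemma bounded_rvM f g :
  bounded_rv f -> bounded_rv g -> bounded_rv (fun x => f x * g x).
Proof.
move=> [mf [a fa]] [mg [b gb]]; split; first exact: measurable_funM.
by exists (a * b) => x; rewrite normrM ler_pM.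
Qed.

Lemma bounded_rv_sum (I : Type) (s : seq I) (f : I -> T -> R) :
  (forall i, bounded_rv (f i)) -> bounded_rv (fun x => \sum_(i <- s) f i x).
Proof.
move=> bf; split; first by apply: measurable_sum => i; case: (bf i).
have /choice[c fc] : forall i, exists c, forall x, `|f i x| <= c.
  by move=> i; case: (bf i).
exists (\sum_(i <- s) c i) => x; apply: le_trans (ler_norm_sum _ _ _) _.
exact: ler_sum.
Qed.

Lemma bounded_rv_indic (A : set T) : measurable A -> bounded_rv (\1_A : T -> R).
Proof.
move=> mA; split; first exact: measurable_indic.
exists 1 => x; rewrite indicE; case: (_ \in _); rewrite ?normr1 ?normr0//.
Qed.

Lemma bounded_rv_integrable (P : probability T R) f :
  bounded_rv f -> P.-integrable setT (EFin \o f).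
Proof.
move=> [mf [c fc]]; apply: measurable_bounded_integrable => //.
  exact: le_lt_trans (probability_le1 P measurableT) (ltry 1).
exists c; split; first by rewrite num_real.
by move=> x cx y _; exact: le_trans (fc y) (ltW cx).
Qed.

Lemma Rintegral_sum (P : probability T R) (I : Type) (s : seq I) (f : I -> T -> R) :
  (forall i, bounded_rv (f i)) ->
  \int[P]_x (\sum_(i <- s) f i x) = \sum_(i <- s) \int[P]_x f i x.
Proof.
move=> bf; elim: s => [|i s ih].
  rewrite big_nil; under eq_Rintegral do rewrite big_nil.
  by rewrite Rintegral_cst// mul0r.
rewrite big_cons -ih; under eq_Rintegral do rewrite big_cons.
by apply: RintegralD => //; apply: bounded_rv_integrable => //; exact: bounded_rv_sum.
Qed.

Lemma Rintegral_indic (P : probability T R) (A : set T) :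
  measurable A -> \int[P]_x (\1_A x) = fine (P A).
Proof. by move=> mA; rewrite /Rintegral integral_indic// setIT. Qed.

Lemma measurable_ge (f : T -> R) c :
  measurable_fun setT f -> measurable [set x | c <= f x].
Proof.
move=> mf; rewrite (_ : [set x | _] = setT `&` f @^-1` `[c, +oo[%classic).
  exact: mf.
by apply/seteqP; split => x /=; rewrite ?in_itv /= andbT => // -[].
Qed.

(** * Matrices with bounded or measurable entries *)

Definition bounded_mx (m n : nat) (X : T -> 'M[R]_(m, n)) : Prop :=
  forall i j, bounded_rv (fun omega => X omega i j).

Lemma bounded_mx_cst (m n : nat) (A : 'M[R]_(m, n)) : bounded_mx (fun _ => A).
Proof. by move=> i j; exact: bounded_rv_cst. Qed.

Lemma bounded_mx_tr (m n : nat) (X : T -> 'M[R]_(m, n)) :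
  bounded_mx X -> bounded_mx (fun omega => (X omega)^T).
Proof. by move=> bX i j; under eq_fun do rewrite mxE. Qed.

Lemma bounded_mxB (m n : nat) (X Y : T -> 'M[R]_(m, n)) :
  bounded_mx X -> bounded_mx Y -> bounded_mx (fun omega => X omega - Y omega).
Proof.
by move=> bX bY i j; under eq_fun do rewrite !mxE; exact: bounded_rvB.
Qed.

Lemma bounded_mxM (m n p : nat) (X : T -> 'M[R]_(m, n)) (Y : T -> 'M[R]_(n, p)) :
  bounded_mx X -> bounded_mx Y -> bounded_mx (fun omega => X omega *m Y omega).
Proof.
move=> bX bY i j; under eq_fun do rewrite !mxE.
by apply: bounded_rv_sum => k; exact: bounded_rvM.
Qed.

Lemma random_matrix_cst (m n : nat) (A : 'M[R]_(m, n)) :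
  random_matrix (fun _ : T => A).
Proof. by move=> i j; exact: measurable_cst. Qed.

Lemma random_matrix_tr (m n : nat) (X : T -> 'M[R]_(m, n)) :
  random_matrix X -> random_matrix (fun omega => (X omega)^T).
Proof. by move=> rX i j; under eq_fun do rewrite mxE; exact: rX. Qed.

Lemma random_matrixD (m n : nat) (X Y : T -> 'M[R]_(m, n)) :
  random_matrix X -> random_matrix Y ->
  random_matrix (fun omega => X omega + Y omega).
Proof.
by move=> rX rY i j; under eq_fun do rewrite !mxE; apply: measurable_funD.
Qed.

Lemma random_matrixB (m n : nat) (X Y : T -> 'M[R]_(m, n)) :
  random_matrix X -> random_matrix Y ->
  random_matrix (fun omega => X omega - Y omega).
Proof.
by move=> rX rY i j; under eq_fun do rewrite !mxE; apply: measurable_funB.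
Qed.

Lemma random_matrixZ (m n : nat) (a : T -> R) (X : T -> 'M[R]_(m, n)) :
  measurable_fun setT a -> random_matrix X ->
  random_matrix (fun omega => a omega *: X omega).
Proof.
by move=> ma rX i j; under eq_fun do rewrite !mxE; apply: measurable_funM.
Qed.

Lemma random_matrixM (m n p : nat) (X : T -> 'M[R]_(m, n)) (Y : T -> 'M[R]_(n, p)) :
  random_matrix X -> random_matrix Y ->
  random_matrix (fun omega => X omega *m Y omega).
Proof.
move=> rX rY i j; under eq_fun do rewrite !mxE.
by apply: measurable_sum => k; exact: measurable_funM.
Qed.

Lemma measurable_enorm (m : nat) (X : T -> 'cV[R]_m) :
  random_matrix X -> measurable_fun setT (fun omega => enorm (X omega)).
Proof.
move=> rX.
have -> : (fun omega => enorm (X omega))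
    = (fun omega => (\sum_i X omega i 0 ^+ 2) `^ 2^-1).
  by apply/funext => omega; rewrite powR12_sqrt// sumr_ge0// => i _; exact: sqr_ge0.
apply: (measurableT_comp (measurable_powR _)).
by apply: measurable_sum => i; exact: measurable_funX.
Qed.

Lemma random_matrix_normalize (m : nat) (X : T -> 'cV[R]_m) :
  random_matrix X -> random_matrix (fun omega => (enorm (X omega))^-1 *: X omega).
Proof.
move=> rX; apply: random_matrixZ => //.
(* The inverse becomes a real power, which is measurable; a zero norm is allowed. *)
under eq_fun do rewrite -(powR_inv1 (enorm_ge0 _)).
exact: (measurableT_comp (measurable_powR _)) (measurable_enorm rX).
Qed.

Lemma measurable_det (m : nat) (X : T -> 'M[R]_m) :
  random_matrix X -> measurable_fun setT (fun omega => \det (X omega)).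
Proof.
move=> rX; apply: measurable_sum => p; apply: measurable_funM => //.
by apply: measurable_prod => i _; exact: rX.
Qed.

(** Only the samples before [t] are assumed measurable, so that the lemma also applies with the
    sigma-algebra of the past. The form of [grouse_stepE] reduces the step to norms and products. *)
Lemma random_matrix_grouse (n d : nat) (Ubar : 'M[R]_(n, d))
    (U0 : T -> 'M[R]_(n, d)) (s : nat -> T -> 'cV[R]_d) (t : nat) :
  (forall omega, orthonormal_cols (U0 omega)) -> random_matrix U0 ->
  (forall u, (u < t)%N -> random_matrix (s u)) ->
  random_matrix (fun omega => grouse (U0 omega) (fun u => Ubar *m s u omega) t).
Proof.
move=> orth rU0; elim: t => [|t ih] rs //=.
have {ih}rU := ih (fun u ut => rs u (ltnW ut)).
have orthU omega :
    orthonormal_cols (grouse (U0 omega) (fun u => Ubar *m s u omega) t).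
  by elim: t {rs rU} => //= t; exact: grouse_step_orthonormal.
under eq_fun do rewrite grouse_stepE//.
have rx : random_matrix (fun omega => Ubar *m s t omega).
  by apply: random_matrixM; [exact: random_matrix_cst|exact: rs].
have rw : random_matrix (fun omega =>
    (grouse (U0 omega) (fun u => Ubar *m s u omega) t)^T *m (Ubar *m s t omega)).
  by apply: random_matrixM => //; exact: random_matrix_tr.
apply: random_matrixD => //; apply: random_matrixM.
  apply: random_matrixB; first exact: random_matrix_normalize.
  by apply: random_matrixM => //; exact: random_matrix_normalize.
by apply: random_matrix_tr; exact: random_matrix_normalize.
Qed.

End bounded_rv.

(** * Decay of the expected error *)

Lemma orthonormal_sum_sqr (R : realType) m n (X : 'M[R]_(m, n)) j :
  orthonormal_cols X -> \sum_i X i j ^+ 2 = 1.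
Proof.
move=> /matrixP/(_ j j); rewrite !mxE eqxx mulr1n => <-; apply: eq_bigr => i _.
by rewrite mxE expr2.
Qed.

Lemma orthonormal_le1 (R : realType) m n (X : 'M[R]_(m, n)) i j :
  orthonormal_cols X -> `|X i j| <= 1.
Proof.
move=> oX; rewrite -(ler_pXn2r (ltn0Sn 1)) ?nnegrE// real_normK ?num_real//.
rewrite expr1n -(orthonormal_sum_sqr j oX) (bigD1 i)//= lerDl.
by rewrite sumr_ge0// => k _; exact: sqr_ge0.
Qed.

Section bounded_overlap.
Variables (disp : measure_display) (T : measurableType disp) (R : realType).
Variables (n d : nat).
Implicit Types U : T -> 'M[R]_(n, d).

Lemma bounded_mx_orthonormal U : random_matrix U ->
  (forall omega, orthonormal_cols (U omega)) -> bounded_mx U.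
Proof.
move=> rU orthU i j; split; first exact: rU.
by exists 1 => omega; exact: orthonormal_le1.
Qed.

Lemma bounded_overlap (Ubar : 'M[R]_(n, d)) U : random_matrix U ->
  (forall omega, orthonormal_cols (U omega)) ->
  bounded_mx (fun omega => overlap Ubar (U omega)).
Proof.
move=> rU /(bounded_mx_orthonormal rU) bU.
have bA : bounded_mx (fun omega => Ubar^T *m U omega).
  by apply: bounded_mxM => //; exact: bounded_mx_cst.
by apply: bounded_mxM => //; exact: bounded_mx_tr.
Qed.

Lemma bounded_rv_epsilon (Ubar : 'M[R]_(n, d)) U : random_matrix U ->
  (forall omega, orthonormal_cols (U omega)) ->
  bounded_rv (fun omega => epsilon Ubar (U omega)).
Proof.
move=> rU orthU; under eq_fun do rewrite epsilonE /mxtrace.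
apply: bounded_rvB; first exact: bounded_rv_cst.
by apply: bounded_rv_sum => i; exact: bounded_overlap.
Qed.

Lemma measurable_zeta_ge (Ubar : 'M[R]_(n, d)) U c : random_matrix U ->
  (forall omega, orthonormal_cols (U omega)) ->
  measurable [set omega | c <= zeta Ubar (U omega)].
Proof.
move=> rU orthU; apply: measurable_ge; under eq_fun do rewrite zetaE.
by apply: measurable_det => i j; case: (bounded_overlap Ubar rU orthU i j).
Qed.
End bounded_overlap.

(** * Second moments of a random direction *)

Section direction.
Variables (disp : measure_display) (Omega : measurableType disp) (R : realType).

Lemma bounded_direction d (s : Omega -> 'cV[R]_d) : random_matrix s ->
  bounded_mx (fun omega => (enorm (s omega))^-1 *: s omega).
Proof.
move=> rs i j; split; first exact: random_matrix_normalize.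
exists 1 => omega; rewrite ord1; have [->|s0] := eqVneq (s omega) 0.
  by rewrite scaler0 mxE normr0.
exact/orthonormal_le1/normalized_unit.
Qed.

Variable P : probability Omega R.

(** The [d] diagonal moments are equal and sum to [P (s != 0) = 1]. *)
Lemma direction_moments d (s : Omega -> 'cV[R]_d) (i j : 'I_d) :
  random_matrix s -> P (s @^-1` [set 0]) = 0%E -> uncorrelated_direction P s ->
  let u := fun omega => (enorm (s omega))^-1 *: s omega in
  \int[P]_omega (u omega i 0 * u omega j 0) = (i == j)%:R / d%:R.
Proof.
move=> rs s0 [offdiag diag] u.
have bu := bounded_direction rs; rewrite -/u in bu.
have [<-|ij] := eqVneq i j; last first.
  by rewrite mul0r; have := offdiag _ _ ij; rewrite unlock /Rintegral => ->.
have buu k : bounded_rv (fun omega => u omega k 0 ^+ 2).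
  by under eq_fun do rewrite expr2; apply: bounded_rvM; exact: bu.
have sumE : \sum_k \int[P]_omega (u omega k 0 ^+ 2) = 1.
  rewrite -Rintegral_sum//.
  have ms0 : measurable (s @^-1` [set 0]).
    rewrite (_ : _ @^-1` _ = setT `&` (fun omega => enorm (s omega)) @^-1` [set 0]).
      exact: (measurable_enorm rs).
    rewrite setTI; apply/seteqP; split => omega /= /eqP.
      by rewrite -enorm_eq0 => /eqP.
    by rewrite enorm_eq0 => /eqP.
  (* The squared entries of the direction sum to 1, except at [s = 0], where the convention
     [0^-1 = 0] makes the direction 0. *)
  transitivity (\int[P]_omega (\1_(~` (s @^-1` [set 0])) omega)).
    apply: eq_Rintegral => omega _; rewrite indicE in_setC.
    have [so|so] := eqVneq (s omega) 0.
      rewrite mem_set//= big1// => k _.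
      by rewrite /u so scaler0 mxE expr0n.
    rewrite memNset/=; last exact/eqP.
    exact/orthonormal_sum_sqr/normalized_unit.
  rewrite Rintegral_indic ?probability_setC ?s0 ?sube0//; exact: measurableC.
under eq_Rintegral do rewrite -expr2.
have d0 : d%:R != 0 :> R by rewrite pnatr_eq0 -lt0n (leq_trans _ (ltn_ord i)).
apply: (mulIf d0); rewrite mul1r mulVf// -[RHS]sumE.
rewrite (eq_bigr (fun=> \int[P]_omega (u omega i 0 ^+ 2))) => [|k _].
  by rewrite sumr_const card_ord mulr_natr.
by rewrite /Rintegral; have := diag k i; rewrite unlock => ->.
Qed.
End direction.

Lemma quadratic_formE (R : comPzRingType) d (M : 'M[R]_d) (u : 'cV[R]_d) :
  (u^T *m M *m u) 0 0 = \sum_i \sum_j u i 0 * u j 0 * M i j.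
Proof.
rewrite mxE exchange_big/=; apply: eq_bigr => j _.
rewrite mxE mulr_suml; apply: eq_bigr => i _; rewrite mxE; ring.
Qed.

(** * GROUSE driven by random coefficients *)

Section grouse_run.
Variables (R : realType) (disp : measure_display) (Omega : measurableType disp).
Variables (P : probability Omega R) (n d : nat).
Hypothesis d_gt0 : (0 < d)%N.
Variables (Ubar : 'M[R]_(n, d)) (U0 : Omega -> 'M[R]_(n, d)).
Variable s : nat -> Omega -> 'cV[R]_d.
Hypotheses (Ubar_orth : orthonormal_cols Ubar) (U0_random : random_matrix U0).
Hypothesis U0_orth : forall omega, orthonormal_cols (U0 omega).
Hypothesis s_model : data_model P U0 s.
Hypothesis s_direction : forall t, uncorrelated_direction P (s t).

Let U (t : nat) (omega : Omega) := grouse (U0 omega) (fun u => Ubar *m s u omega) t.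
Let start k := [set omega | 1 / 2 <= zeta Ubar (U k omega)].

Lemma grouse_orthonormal t omega : orthonormal_cols (U t omega).
Proof. by elim: t => //= t; exact: grouse_step_orthonormal. Qed.

(** Induction by monotonicity of [zeta]; the bound itself supplies the positivity required at the
    next step. *)
Lemma zeta_grouse_ge k t omega : (k <= t)%N -> start k omega ->
  1 / 2 <= zeta Ubar (U t omega).
Proof.
move=> /subnKC <- zk; elim: (t - k)%N => [|m ih]; first by rewrite addn0.
rewrite addnS; apply: (le_trans ih); apply: zeta_grouse_step => //.
  exact: grouse_orthonormal.
by apply: lt_le_trans ih; rewrite divr_gt0.
Qed.

Lemma random_grouse t : random_matrix (U t).
Proof.
by apply: random_matrix_grouse => // u _; case: s_model.
Qed.

Let G t := mx_events U0 `|` \bigcup_(u in [set u | (u < t)%N]) mx_events (s u).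

(* Measurability with respect to the past is measurability on the copy
   [g_sigma_algebraType] of [Omega] carrying the generated sigma-algebra. *)
Lemma random_matrix_mx_events (H : set (set Omega)) p q (X : Omega -> 'M[R]_(p, q)) :
  mx_events X `<=` H -> random_matrix (X : g_sigma_algebraType H -> _).
Proof.
move=> XH i j _ B mB; apply: sub_sigma_algebra; apply: XH.
by exists i, j; exists B.
Qed.

(** The iterate [U k] depends on [U0] and on samples before [k <= t] only. Both [k] itself, for the
    starting event, and [k = t], for the current gap, are needed. *)
Lemma random_grouse_past t k : (k <= t)%N ->
  random_matrix (U k : g_sigma_algebraType (G t) -> _).
Proof.
move=> kt; apply: random_matrix_grouse => //.
  by apply: random_matrix_mx_events => A; left.
move=> u uk; apply: random_matrix_mx_events => A; right.
by exists u => //=; exact: leq_trans uk kt.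
Qed.

Let gap t omega := overlap Ubar (U t omega) - overlap Ubar (U t omega) *m overlap Ubar (U t omega).

(** The direction is a function of [s t], while the gap and the starting event belong to the past;
    independence factors the expectation. *)
Lemma expected_gap t k i j : (k <= t)%N ->
  let u := fun omega => (enorm (s t omega))^-1 *: s t omega in
  \int[P]_omega (u omega i 0 * u omega j 0 * (gap t omega i j * \1_(start k) omega))
  = (i == j)%:R / d%:R * \int[P]_omega (gap t omega i j * \1_(start k) omega).
Proof.
move=> kt u; have rs : random_matrix (s t) by case: s_model.
have bX : bounded_rv (fun omega => u omega i 0 * u omega j 0).
  by apply: bounded_rvM; exact: bounded_direction.
(* The primed versions hold over the generated sigma-algebras, as [coef_indep] requires; the
   unprimed ones serve for integration on [Omega]. *)
have bX' : bounded_rv ((fun omega => u omega i 0 * u omega j 0)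
    : g_sigma_algebraType (mx_events (s t)) -> R).
  by apply: bounded_rvM; apply: bounded_direction; exact: random_matrix_mx_events.
have bgap disp' (T : measurableType disp') (V : T -> 'M[R]_(n, d)) :
    random_matrix V -> (forall omega, orthonormal_cols (V omega)) ->
    bounded_mx (fun omega => overlap Ubar (V omega) - overlap Ubar (V omega) *m overlap Ubar (V omega)).
  by move=> rV oV; apply: bounded_mxB; last apply: bounded_mxM; exact: bounded_overlap.
have bY : bounded_rv (fun omega => gap t omega i j * \1_(start k) omega).
  apply: bounded_rvM; first by apply: bgap; [exact: random_grouse|exact: grouse_orthonormal].
  by apply: bounded_rv_indic; apply: measurable_zeta_ge; [exact: random_grouse|exact: grouse_orthonormal].
have bY' : bounded_rv ((fun omega => gap t omega i j * \1_(start k) omega)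
    : g_sigma_algebraType (G t) -> R).
  apply: bounded_rvM; first by apply: bgap; [exact: random_grouse_past|exact: grouse_orthonormal].
  by apply: bounded_rv_indic; apply: measurable_zeta_ge; [exact: random_grouse_past|exact: grouse_orthonormal].
rewrite -(direction_moments i j rs (coef_continuous s_model t 0) (s_direction t)).
apply: Rintegral_independentM.
- by case: bX.
- by case: bY.
- exact: bounded_rv_integrable.
- exact: bounded_rv_integrable.
- by apply: bounded_rv_integrable; exact: bounded_rvM.
- move=> A B mA mB; apply: (coef_indep s_model).
    by have := bX'.1 measurableT A mA; rewrite setTI; exact.
  by have := bY'.1 measurableT B mB; rewrite setTI; exact.
Qed.

(** Multiplying by the indicator replaces conditioning on the starting event. *)
Let epsS k t omega := epsilon Ubar (U t omega) * \1_(start k) omega.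

Let start_measurable k : measurable (start k).
Proof.
by apply: measurable_zeta_ge; [exact: random_grouse|exact: grouse_orthonormal].
Qed.

Let bounded_epsS k t : bounded_rv (epsS k t).
Proof.
apply: bounded_rvM; last exact: bounded_rv_indic.
by apply: bounded_rv_epsilon; [exact: random_grouse|exact: grouse_orthonormal].
Qed.

Lemma expected_epsilon_contract k t : (k <= t)%N ->
  \int[P]_omega (epsS k t.+1 omega)
  <= (1 - (2 * d%:R)^-1) * \int[P]_omega (epsS k t omega).
Proof.
move=> kt.
pose u omega := (enorm (s t omega))^-1 *: s t omega.
pose Z i j omega := u omega i 0 * u omega j 0 * (gap t omega i j * \1_(start k) omega).
have bu : bounded_mx u by apply: bounded_direction; case: s_model.
have bgap : bounded_mx (gap t).
  have bO : bounded_mx (fun omega => overlap Ubar (U t omega)).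
    by apply: bounded_overlap; [exact: random_grouse|exact: grouse_orthonormal].
  by apply: bounded_mxB => //; exact: bounded_mxM.
have bgapS i : bounded_rv (fun omega => gap t omega i i * \1_(start k) omega).
  by apply: bounded_rvM; [exact: bgap|exact: bounded_rv_indic].
have bZ i j : bounded_rv (Z i j).
  apply: bounded_rvM; first by apply: bounded_rvM; exact: bu.
  by apply: bounded_rvM; [exact: bgap|exact: bounded_rv_indic].
have bZZ i : bounded_rv (fun omega => \sum_j Z i j omega) by exact: bounded_rv_sum.
have d0 : 0 < d%:R :> R by rewrite ltr0n.
(* The pointwise drop comes first; off the starting event both integrands vanish. *)
apply: (@le_trans _ _ (\int[P]_omega (epsS k t omega - \sum_i \sum_j Z i j omega))).
  apply: le_Rintegral => //; try apply: bounded_rv_integrable => //.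
    by apply: bounded_rvB => //; exact: bounded_rv_sum.
  move=> omega _; rewrite /epsS /Z indicE.
  have [/set_mem So|_] := boolP (omega \in start k); last first.
    rewrite !mulr0 big1 ?subr0// => i _; rewrite big1// => j _.
    by rewrite !mulr0.
  rewrite !mulr1; under eq_bigr do under eq_bigr do rewrite mulr1.
  rewrite -quadratic_formE; apply: epsilon_grouse_step => //.
    exact: grouse_orthonormal.
  by apply: lt_le_trans (zeta_grouse_ge kt So); rewrite divr_gt0.
rewrite RintegralB//; try (apply: bounded_rv_integrable => //; exact: bounded_rv_sum).
rewrite mulrBl mul1r lerD2l lerN2 Rintegral_sum//.
(* Off-diagonal moments vanish and diagonal ones are [1 / d], which leaves the trace of the gap
   divided by [d]. *)
have -> : \sum_i \int[P]_omega (\sum_j Z i j omega)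
    = \sum_i (d%:R)^-1 * \int[P]_omega (gap t omega i i * \1_(start k) omega).
  apply: eq_bigr => i _; rewrite Rintegral_sum//.
  rewrite (bigD1 i)//= big1 => [|j ji]; rewrite expected_gap//.
    by rewrite eqxx addr0 div1r.
  by rewrite eq_sym (negPf ji) !mul0r.
rewrite -mulr_sumr -Rintegral_sum//.
(* After cancelling [1 / d], the remaining factor [1 / 2] is the one of [epsilon_zeta_half]. *)
rewrite invfM [2^-1 * _]mulrC -mulrA ler_pM2l ?invr_gt0//.
rewrite -RintegralZl//; last exact: bounded_rv_integrable.
apply: le_Rintegral => //; try apply: bounded_rv_integrable => //.
  by apply: bounded_rvM => //; exact: bounded_rv_cst.
  exact: bounded_rv_sum.
move=> omega _; rewrite /epsS -mulr_suml mulrA indicE.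
have [/set_mem So|_] := boolP (omega \in start k); last by rewrite !mulr0.
rewrite !mulr1 mulrC.
by have [_] := epsilon_zeta_half Ubar_orth (grouse_orthonormal t omega) (zeta_grouse_ge kt So).
Qed.

(** The base case uses [epsilon <= 1] on the starting event, so no factor [d] appears in front. *)
Lemma expected_epsilon_decay k m :
  \int[P]_omega (epsS k (k + m)%N omega)
  <= (1 - (2 * d%:R)^-1) ^+ m * fine (P (start k)).
Proof.
have c0 : 0 <= 1 - (2 * d%:R)^-1 :> R.
  rewrite subr_ge0 invf_le1 ?mulr_gt0 ?ltr0n//.
  by rewrite -natrM ler1n muln_gt0.
elim: m => [|m ih].
  rewrite addn0 expr0 mul1r -Rintegral_indic//.
  apply: le_Rintegral => //; try apply: bounded_rv_integrable => //.
    exact: bounded_rv_indic.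
  move=> omega _; rewrite /epsS indicE.
  have [/set_mem So|_] := boolP (omega \in start k); last by rewrite !mulr0.
  rewrite !mulr1.
  by have [] := epsilon_zeta_half Ubar_orth (grouse_orthonormal k omega) So.
rewrite addnS exprS -mulrA.
apply: le_trans (expected_epsilon_contract (leq_addr m k)) _.
exact: ler_wpM2l.
Qed.

(** Markov's inequality for [epsS]; the left side is the probability of starting well and still
    missing the accuracy. *)
Lemma grouse_tail k m (eps : R) : 0 < eps ->
  fine (P (start k)) - fine (P ([set omega | epsilon Ubar (U (k + m)%N omega) <= eps] `&` start k))
  <= (1 - (2 * d%:R)^-1) ^+ m * fine (P (start k)) / eps.
Proof.
move=> eps0; set A := [set omega | _].
have mA : measurable A.
  rewrite (_ : A = [set omega | - eps <= 0 - epsilon Ubar (U (k + m)%N omega)]).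
    apply: measurable_ge; apply: measurable_funB => //.
    by case: (bounded_rv_epsilon Ubar (random_grouse (k + m)) (grouse_orthonormal (k + m))).
  by apply/seteqP; split => omega /=; rewrite sub0r lerN2.
have mAS : measurable (A `&` start k) by exact: measurableI.
rewrite ler_pdivlMr// mulrC.
apply: le_trans (expected_epsilon_decay k m).
rewrite -!Rintegral_indic// -RintegralB//; try (apply: bounded_rv_integrable; exact: bounded_rv_indic).
rewrite -RintegralZl//; last first.
  by apply: bounded_rv_integrable; apply: bounded_rvB; exact: bounded_rv_indic.
apply: le_Rintegral => //; try apply: bounded_rv_integrable => //.
  by apply: bounded_rvM; [exact: bounded_rv_cst|apply: bounded_rvB; exact: bounded_rv_indic].
move=> omega _; rewrite /epsS !indicE in_setI.
(* Where the accuracy is reached, the bound is nonnegativity of [epsilon]; elsewhere it is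
   [eps < epsilon]. *)
have /andP[e0 _] := epsilon_bounds Ubar_orth (grouse_orthonormal (k + m) omega).
have [So|_] := boolP (omega \in start k); last by rewrite andbF subr0 !mulr0.
rewrite andbT mulr1; have [Ao|nA] := boolP (omega \in A).
  by rewrite subrr mulr0.
rewrite subr0 mulr1; apply/ltW; rewrite ltNge; apply: contra nA => ?.
exact: mem_set.
Qed.

End grouse_run.

(** From [1 - 1 / c <= exp (- 1 / c)] with [c = 2 d], the power is at most [exp (- K / c)]. *)
Lemma contraction_power_le (R : realType) (d K : nat) (x : R) : (0 < d)%N -> 0 < x ->
  2 * d%:R * ln (1 / x) <= K%:R -> (1 - (2 * d%:R)^-1) ^+ K <= x.
Proof.
move=> d0 x0 hK; set c := 2 * d%:R.
have c0 : 0 < c by rewrite mulr_gt0 ?ltr0n.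
have c1 : 0 <= 1 - c^-1.
  by rewrite subr_ge0 invf_le1// /c -natrM ler1n muln_gt0.
apply: (@le_trans _ _ (expR (- c^-1) ^+ K)).
  by apply: lerXn2r; rewrite ?nnegrE ?expR_ge0//; exact: expR_ge1Dx.
rewrite -expRM_natr -[leRHS]lnK ?posrE// ler_expR.
rewrite div1r lnV ?posrE// in hK.
have : K%:R / c >= - ln x by rewrite ler_pdivlMr// mulrC.
rewrite mulNr [c^-1 * _]mulrC; lra.
Qed.

Unset Implicit Arguments.

(** As [U k] is random, the assumption on iteration [k] is an event and the conclusion is
    conditional on it; its positive probability makes the quotient meaningful. *)
Theorem theorem6 (R : realType) (disp : measure_display)
    (Omega : measurableType disp) (P : probability Omega R) (n d : nat)
    (d_gt0 : (0 < d)%N) (d_lt_n : (d < n)%N)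
    (Ubar : 'M[R]_(n, d)) (Ubar_orth : orthonormal_cols Ubar)
    (U0 : Omega -> 'M[R]_(n, d)) (U0_random : random_matrix U0)
    (U0_orth : forall omega, orthonormal_cols (U0 omega))
    (s : nat -> Omega -> 'cV[R]_d) (s_model : data_model P U0 s)
    (s_direction : forall t, uncorrelated_direction P (s t)) (k : nat) :
  let U := fun (t : nat) (omega : Omega) =>
    grouse (U0 omega) (fun u => Ubar *m s u omega) t in
  let start := [set omega | 1 / 2 <= zeta Ubar (U k omega)] in
  (0 < P start)%E ->
  forall (rho eps : R) (K2 : nat), 0 < rho < 1 -> 0 < eps ->
    2 * d%:R * ln (1 / (eps * rho)) <= K2%:R ->
    1 - rho <=
      cond_prob P [set omega | epsilon Ubar (U (k + K2)%N omega) <= eps] start.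
Proof.
move=> U start start_gt0 rho eps K2 /andP[rho0 _] eps0 hK.
have mstart : measurable start.
  apply: measurable_zeta_ge; first exact: (random_grouse _ U0_random U0_orth s_model).
  exact: grouse_orthonormal.
have p0 : 0 < fine (P start).
  by rewrite fine_gt0// start_gt0/= (le_lt_trans (probability_le1 P mstart))// ltry.
have := grouse_tail d_gt0 Ubar_orth U0_random U0_orth s_model s_direction k K2 eps0.
rewrite -/U -/start /cond_prob; set A := [set omega | _] => tail.
(* Multiplied by [P start], the claim bounds the tail by [rho * P start]; since [grouse_tail]
   divides by [eps], the power has to be at most [eps * rho]. *)
rewrite ler_pdivlMr// mulrBl mul1r lerBlDr -lerBlDl.
apply: (le_trans tail); rewrite ler_pdivrMr//.
rewrite [leRHS]mulrAC [rho * eps]mulrC ler_wpM2r ?(ltW p0)//.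
exact: contraction_power_le d_gt0 (mulr_gt0 eps0 rho0) hK.
Qed.
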